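(* There exists an absolute constant $c>0$ such that for every positive integer $n$ and every $n$-vertex graph $H$ with average degree $d$, we have $ER(H)\ge n^{cd}$.
   Context: Edge-colorings of $K_N$ may use arbitrarily many colors. A copy of $H$ in $K_N$ (injective $\varphi:V(H)\to V(K_N)$) is canonically colored if it is monochromatic (all edges same color), rainbow (all edges distinct colors), or lexicographic: there is an ordering $v_1,\dots,v_n$ of $V(H)$ such that for each $i$ all edges $\varphi(v_i)\varphi(v_j)$ with $v_iv_j\in E(H)$, $j>i$, have the same color $c_i$, and these colors are distinct for different $v_i$. $ER(H)$ is the least $N$ such that every edge-coloring of $K_N$ contains a canonically colored copy of $H$. *)

(* Defs.v *)
From HB Require Import structures.
From mathcomp Require Import all_boot all_order all_algebra zify.
From mathcomp Require Import boolp reals exp.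

Set Implicit Arguments.
Unset Strict Implicit.
Unset Printing Implicit Defensive.

Record sgraph := SGraph {
  vertex :> finType;
  edge : rel vertex;
  edge_sym : symmetric edge;
  edge_irr : irreflexive edge }.

Definition degree (H : sgraph) (x : H) : nat := #|[set y | edge x y]|.

Definition avg_degree (R : realType) (H : sgraph) : R :=
  ((\sum_(x : H) degree x)%:R / #|H|%:R)%R.

(* An edge of K_N is a two-element set, so an edge-coloring of K_N is a map
   [chi : {set 'I_N} -> nat], of which only the values on two-element sets
   are ever used. *)
Section Canonical.
Variables (H : sgraph) (N : nat) (chi : {set 'I_N} -> nat) (phi : H -> 'I_N).

Definition monochromatic : Prop :=
  exists a : nat, forall x y : H, edge x y -> chi [set phi x; phi y] = a.

Definition rainbow : Prop :=
  forall x y x' y' : H, edge x y -> edge x' y' ->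
    chi [set phi x; phi y] = chi [set phi x'; phi y'] ->
    [set x; y] = [set x'; y'].

(* When [v i] has no later neighbour its color [c i] is constrained only by
   the injectivity of [c], which can always be met as [nat] is infinite. *)
Definition lexicographic : Prop :=
  exists v : 'I_#|H| -> H, bijective v /\
  exists c : 'I_#|H| -> nat, injective c /\
    forall i j : 'I_#|H|, i < j -> edge (v i) (v j) ->
      chi [set phi (v i); phi (v j)] = c i.

Definition canonical : Prop := monochromatic \/ rainbow \/ lexicographic.

End Canonical.

Definition canonical_unavoidable (H : sgraph) (N : nat) : Prop :=
  forall chi : {set 'I_N} -> nat,
    exists phi : H -> 'I_N, injective phi /\ canonical chi phi.

(* The Erdős–Rado canonical Ramsey theorem, which makes [ER] well defined. A
   set in which no vertex sees many others in one color contains a rainbow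
   clique; otherwise one can pass to a large set of neighbours in one color,
   and iterating this gives a sequence in which the color of a pair depends
   only on its first element. *)
Section ErdosRado.
Variables (T : finType) (chi : {set T} -> nat).
Let col (x y : T) := chi [set x; y].

Let colC x y : col x y = col y x.
Proof. by rewrite /col setUC. Qed.

Definition color_nbr (S : {set T}) v a := [set u in S | (u != v) && (col v u == a)].

Definition rainbow_set (s : {set T}) :=
  forall x y x' y', x \in s -> y \in s -> x' \in s -> y' \in s ->
    x != y -> x' != y' -> col x y = col x' y' -> [set x; y] = [set x'; y'].

Let card_bigcup (I : finType) (P : pred I) (F : I -> {set T}) b :
  (forall i, P i -> #|F i| <= b) -> #|\bigcup_(i | P i) F i| <= #|P| * b.
Proof.
move=> Fb; have : #|\bigcup_(i | P i) F i| <= \sum_(i | P i) #|F i|.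
  elim/big_ind2 : _ => [|A a B a' Aa Bb|//]; first by rewrite cards0.
  by apply: leq_trans (leq_card_setU _ _) (leq_add Aa Bb).
move=> /leq_trans; apply.
by rewrite -sum_nat_const; apply: leq_sum => i /Fb.
Qed.

Section Greedy.
Variables (k D : nat) (S : {set T}).
Hypothesis degS : forall v a, v \in S -> #|color_nbr S v a| <= D.

Let m := 2 * (k * k).
Let E (t t' : T) := [set v in S | [&& v != t, v != t' & col v t == col v t']].
Let bad t := [set t' in S | (t' != t) && (#|S| < m * #|E t t'|)].

Let EC t t' : E t t' = E t' t.
Proof. by apply/setP=> v; rewrite !inE eq_sym [col v t == _]eq_sym; case: (v \in S); rewrite //= andbCA eq_sym. Qed.

Let card_bad t : 0 < #|S| -> #|bad t| <= m * D.
Proof.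
move=> S0; rewrite -(leq_pmul2r S0).
have H1 : #|bad t| * #|S| <= \sum_(t' in bad t) m * #|E t t'|.
  rewrite -sum_nat_const; apply: leq_sum => t'.
  by rewrite inE => /and3P[_ _ /ltnW].
apply: leq_trans H1 _; rewrite -big_distrr /= -mulnA leq_mul2l; apply/orP; right.
have -> : \sum_(t' in bad t) #|E t t'|
    = \sum_(v in S) \sum_(t' in bad t | v \in E t t') 1.
  under eq_bigr => t' _ do rewrite -sum1_card.
  rewrite (exchange_big_dep (mem S)) //= => t' v _.
  by rewrite inE => /andP[].
rewrite mulnC -sum_nat_const; apply: leq_sum => v vS.
rewrite sum1dep_card; apply: leq_trans (degS (col v t) vS).
apply: subset_leq_card; apply/subsetP => t'; rewrite !inE.
by move=> /andP[/and3P[-> _ _] /and4P[_ _ vt' /eqP->]]; rewrite eq_sym vt' eqxx.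
Qed.

Hypothesis bigS : 2 * (k + k * (m * D) + k * k * k * D) < #|S|.

Lemma greedy_rainbow j : j <= k -> exists s : {set T},
  [/\ s \subset S, #|s| = j, rainbow_set s &
      forall t t', t \in s -> t' \in s -> t != t' -> m * #|E t t'| <= #|S|].
Proof.
have S0 : 0 < #|S| by apply: leq_ltn_trans bigS.
elim: j => [_|j IH jk].
  exists set0; rewrite sub0set cards0; split=> //.
    by move=> x ?????; rewrite inE.
  by move=> x ?; rewrite inE.
have [s [sS sj rs gs]] := IH (ltnW jk).
pose B1 := \bigcup_(t in s) bad t.
pose B2 := \bigcup_(q in setX s (setX s s)) color_nbr S q.1 (col q.2.1 q.2.2).
pose B3 := \bigcup_(q in [set q in setX s s | q.1 != q.2]) E q.1 q.2.
have cB1 : #|B1| <= k * (m * D).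
  apply: (@leq_trans (j * (m * D))); last by rewrite leq_mul2r ltnW ?orbT.
  by rewrite -sj; apply: card_bigcup => t _; apply: card_bad.
have cB2 : #|B2| <= k * k * k * D.
  apply: (@leq_trans (#|setX s (setX s s)| * D)).
    apply: card_bigcup => q; rewrite !inE => /andP[qs _].
    by apply: degS; apply: (subsetP sS).
  rewrite !cardsX sj leq_mul2r; apply/orP; right.
  by rewrite -mulnA; do !apply: leq_mul => //; apply: ltnW.
have cB3 : 2 * #|B3| <= #|S|.
  have k0 : 0 < k * k by rewrite muln_gt0; lia.
  rewrite -(leq_pmul2l k0) mulnCA mulnA -/m.
  have m0 : 0 < m by rewrite muln_gt0.
  have := @card_bigcup _ (mem [set q in setX s s | q.1 != q.2])
    (fun q => E q.1 q.2) (#|S| %/ m).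
  rewrite -/B3 => H; apply: leq_trans (leq_mul (leqnn m) (H _)) _.
    move=> q; rewrite !inE => /andP[/andP[q1 q2] q12].
    by rewrite leq_divRL // mulnC gs.
  have c0 : #|mem [set q in setX s s | q.1 != q.2]| <= k * k.
    apply: (@leq_trans #|setX s s|).
      by apply: subset_leq_card; apply/subsetP => q; rewrite inE => /andP[].
    by rewrite cardsX sj; apply: leq_mul; apply: ltnW.
  rewrite mulnCA; apply: leq_mul => //.
  by rewrite mulnC leq_trunc_div.
have [v vS] : exists2 v, v \in S & v \notin s :|: B1 :|: B2 :|: B3.
  apply/subsetPn; apply/negP => /subset_leq_card.
  have := (leq_card_setU (s :|: B1 :|: B2) B3).1.
  have := (leq_card_setU (s :|: B1) B2).1.
  have := (leq_card_setU s B1).1.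
  move: cB1 cB2 cB3 bigS jk; rewrite -sj.
  move: (k * (m * D)) (k * k * k * D) => p q; lia.
rewrite !inE !negb_or => /andP[/andP[/andP[vs vB1] vB2] vB3].
have nv t : t \in s -> v != t by apply: contraTneq => <-.
have P2 t x y : t \in s -> x \in s -> y \in s -> col t v <> col x y.
  move=> ts xs ys e; move/bigcupP: vB2; apply; exists (t, (x, y)).
    by rewrite !inE ts xs ys.
  by rewrite !inE vS nv //= e.
have P3 t x : t \in s -> x \in s -> col v t = col v x -> t = x.
  move=> ts xs e; apply/eqP/negPn/negP => tx.
  move/bigcupP: vB3; apply; exists (t, x); first by rewrite !inE ts xs.
  by rewrite !inE vS !nv //= e.
have P1 t : t \in s -> m * #|E t v| <= #|S|.
  move=> ts; rewrite leqNgt; apply/negP => b.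
  by move/bigcupP: vB1; apply; exists t => //; rewrite inE vS nv.
exists (v |: s); split.
- by rewrite subUset sub1set vS.
- by rewrite cardsU1 vs sj.
- move=> x y x' y'; rewrite !inE.
  move=> /orP[/eqP->|xs] /orP[/eqP->|ys] /orP[/eqP->|x's] /orP[/eqP->|y's];
    rewrite ?eqxx // => n1 n2 e.
  + by rewrite (P3 _ _ ys y's e).
  + by rewrite (P3 _ _ ys x's (etrans e (colC _ _))) setUC.
  + by case: (P2 _ _ _ ys x's y's (etrans (colC _ _) e)).
  + by rewrite (P3 _ _ xs y's (etrans (colC _ _) e)) setUC.
  + by rewrite (P3 _ _ xs x's (etrans (colC _ _) (etrans e (colC _ _)))).
  + by case: (P2 _ _ _ xs x's y's e).
  + by case: (P2 _ _ _ y's xs ys (etrans (colC _ _) (esym e))).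
  + by case: (P2 _ _ _ x's xs ys (esym e)).
  + exact: rs.
- move=> t t'; rewrite !inE => /orP[/eqP->|ts] /orP[/eqP->|t's];
    rewrite ?eqxx // => n; last exact: gs.
    by rewrite EC P1.
  exact: P1.
Qed.

End Greedy.

(* [p.2] is the color of all pairs formed by [p.1] and a later element. *)
Definition lex_seq (s : seq (T * nat)) :=
  uniq (map fst s) && pairwise (fun p q => col p.1 q.1 == p.2) s.

Fixpoint lex_bound (k n : nat) : nat :=
  if n is n'.+1 then
    let D := lex_bound k n' in
    (2 * (k + k * (2 * (k * k) * D) + k * k * k * D)).+1
  else 0.

Lemma rainbow_or_lex k n (S : {set T}) : lex_bound k n <= #|S| ->
  (exists2 s : {set T}, #|s| = k & rainbow_set s) \/
  (exists s, [/\ lex_seq s, size s = n & {subset map fst s <= S}]).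
Proof.
elim: n S => [|n IH] S; first by right; exists [::].
rewrite /= => bigS.
have [/existsP[v /andP[vS /hasP[a _ va]]]|nex] := boolP [exists v in S,
    has (fun a => lex_bound k n < #|color_nbr S v a|) [seq col v u | u <- enum T]].
  have [|[s [ls sn sS]]] := IH _ (ltnW va); first by left.
  right; exists ((v, a) :: s); split; last 1 first.
  - move=> x; rewrite inE => /orP[/eqP->//|/sS].
    by rewrite inE => /andP[].
  - move: ls => /andP[us ps]; rewrite /lex_seq /= us ps !andbT.
    apply/andP; split.
      by apply/negP => /sS; rewrite !inE eqxx /= andbF.
    apply/allP => q qs /=; have /sS : q.1 \in map fst s by exact: map_f.
    by rewrite inE => /and3P[].
  - by rewrite /= sn.
left.
have degS v a : v \in S -> #|color_nbr S v a| <= lex_bound k n.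
  move=> vS; rewrite leqNgt; apply/negP => va.
  move/negP: nex; apply; apply/existsP; exists v; rewrite vS /=.
  apply/hasP; exists a => //.
  have /card_gt0P[u] : 0 < #|color_nbr S v a| by apply: leq_ltn_trans va.
  by rewrite inE => /and3P[_ _ /eqP<-]; rewrite map_f ?mem_enum.
have [s [_ sk rs _]] := greedy_rainbow degS bigS (leqnn k).
by exists s.
Qed.

Lemma pigeonhole k r (s : seq (T * nat)) : r * k <= size s ->
  (exists a, k <= count (fun p => p.2 == a) s) \/
  (exists s', [/\ subseq s' s, uniq (map snd s') & size s' = r]).
Proof.
have [->|k0] := posnP k; first by left; exists 0.
elim: r s => [|r IH] s; first by right; exists [::]; rewrite sub0seq.
case: s => [|p s]; first by rewrite mulSn /=; lia.
move=> sz; have [ck|ck] := leqP k (count (fun q => q.2 == p.2) (p :: s)).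
  by left; exists p.2.
have /IH[[a]|[s' [ss us sr]]] : r * k <= size [seq q <- s | q.2 != p.2].
- rewrite size_filter -(leq_add2l (count (fun q => q.2 == p.2) s)).
  rewrite (count_predC (fun q => q.2 == p.2) s).
  move: ck; rewrite /= eqxx add1n => /ltnW ck.
  by rewrite -ltnS -addSn; apply: leq_trans sz; rewrite mulSn leq_add2r.
- rewrite count_filter => ka; left; exists a; apply: leq_trans ka _.
  rewrite /= -[X in X <= _]add0n; apply: leq_add => //.
  by apply: sub_count => q /= /andP[].
right; exists (p :: s'); split.
- by rewrite /= eqxx; apply: subseq_trans ss (filter_subseq _ _).
- rewrite /= us andbT; apply/mapP => -[q /(mem_subseq ss)].
  by rewrite mem_filter => /andP[/eqP n _] e; apply: n.
- by rewrite /= sr.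
Qed.

Lemma sub_lex_seq s' s : subseq s' s -> lex_seq s -> lex_seq s'.
Proof.
move=> ss /andP[us ps]; apply/andP; split.
  by apply: subseq_uniq us; apply: map_subseq.
exact: subseq_pairwise ss ps.
Qed.

End ErdosRado.

Lemma ER_exists (H : sgraph) : exists N, `[< canonical_unavoidable H N >].
Proof.
set k := #|H|; exists (lex_bound k (k * k)); apply/asboolP => chi.
have := @rainbow_or_lex _ chi k (k * k) setT.
rewrite cardsT card_ord => /(_ (leqnn _)) [[s sk rs]|[s [ls sz _]]].
  have rk (x : H) : enum_rank x < #|s| by rewrite sk.
  have phiI : injective (fun x : H => enum_val (Ordinal (rk x))).
    move=> x y /enum_val_inj/(congr1 val)/= e.
    by apply: enum_rank_inj; apply: val_inj.
  set phi := fun x : H => _ in phiI.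
  exists phi; split=> //; right; left => x y x' y' xy xy' e.
  have nE (u v : H) : edge u v -> phi u != phi v.
    by apply: contraTneq => /phiI->; rewrite edge_irr.
  have im : [set phi x; phi y] = [set phi x'; phi y'].
    by apply: rs; rewrite ?enum_valP ?nE.
  apply: (imset_inj phiI).
  by rewrite !imsetU !imset_set1.
have embed (s' : seq ('I_(lex_bound k (k * k)) * nat)) :
    lex_seq chi s' -> k <= size s' ->
    exists f : 'I_k -> 'I_(lex_bound k (k * k)) * nat,
      [/\ injective (fst \o f),
          forall i, f i \in s',
          uniq (map snd s') -> injective (snd \o f) &
          forall i j : 'I_k, i < j -> chi [set (f i).1; (f j).1] = (f i).2].
  move=> /andP[us ps] ks.
  have lt (i : 'I_k) : i < size s' := leq_trans (ltn_ord i) ks.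
  exists (fun i => tnth (in_tuple s') (Ordinal (lt i))).
  have nE i p0 : tnth (in_tuple s') (Ordinal (lt i)) = nth p0 s' i.
    by rewrite (tnth_nth p0).
  split.
  - move=> i j /=; case: (s') us lt nE => [|p0 t] us lt nE; first by have := lt i.
    rewrite !(nE _ p0) -!(nth_map _ p0.1) // => /eqP.
    by rewrite nth_uniq ?size_map // => /eqP/val_inj.
  - by move=> i; apply: mem_tnth.
  - move=> us2 i j /=; case: (s') us2 lt nE => [|p0 t] us2 lt nE; first by have := lt i.
    rewrite !(nE _ p0) -!(nth_map _ p0.2) // => /eqP.
    by rewrite nth_uniq ?size_map // => /eqP/val_inj.
  - move=> i j ij; case: (s') ps lt nE => [|p0 t] ps lt nE; first by have := lt i.
    by rewrite !(nE _ p0); apply/eqP; move/(pairwiseP p0): ps; apply; rewrite ?inE.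
have /pigeonhole[[a ka]|[s' [ss us sr]]] : k * k <= size s by rewrite sz.
  rewrite -size_filter in ka.
  have [f [fI fs _ fc]] := embed _ (sub_lex_seq (filter_subseq _ _) ls) ka.
  exists (fst \o f \o enum_rank); split.
    by apply: inj_comp fI enum_rank_inj.
  left; exists a => x y xy /=.
  have fa i : (f i).2 = a by have := fs i; rewrite mem_filter => /andP[/eqP].
  have : enum_rank x != enum_rank y.
    by apply: contraTneq xy => /enum_rank_inj->; rewrite edge_irr.
  rewrite -val_eqE neq_ltn => /orP[/fc->//|/fc].
  by rewrite setUC => ->.
have [f [fI _ /(_ us) cI fc]] := embed _ (sub_lex_seq ss ls) (eq_leq (esym sr)).
exists (fst \o f \o enum_rank); split.
  by apply: inj_comp fI enum_rank_inj.
right; right; exists enum_val; split; first exact: enum_val_bij.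
exists (snd \o f); split=> // i j ij _.
by rewrite /= !enum_valK fc.
Qed.

Definition ER (H : sgraph) : nat := ex_minn (ER_exists H).

(* Main.v *)
(* Color K_N uniformly at random with n = |H| colors. A rainbow copy is
   impossible since H has more than n edges. A monochromatic or lexicographic
   copy is described by the embedding, an ordering of V(H) and one color per
   vertex, hence by one of at most N^n n^(2n) data, and each datum prescribes
   the colors of all e(H) = nd/2 edges of the copy. So n^(nd/2) <= N^n n^(2n)
   whenever N is unavoidable, which is the claim for large d. For small d the
   bound N >= n suffices. *)
Require Import Defs.
From mathcomp Require Import all_boot all_order all_algebra.
From mathcomp Require Import reals exp.
From mathcomp Require Import zify.

Set Implicit Arguments.
Unset Strict Implicit.
Unset Printing Implicit Defensive.

(** * Cardinalities of unions and of sets of functions with prescribed values *)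

Lemma card_bigcup_le (I T : finType) (P : pred I) (F : I -> {set T}) b :
  (forall i, P i -> #|F i| <= b) -> #|\bigcup_(i | P i) F i| <= #|I| * b.
Proof.
move=> Fb; apply: (@leq_trans (\sum_(i | P i) #|F i|)).
  elim/big_ind2 : _ => [|A a B a' Aa Bb|//]; first by rewrite cards0.
  by apply: leq_trans (leq_card_setU _ _) (leq_add Aa Bb).
apply: (@leq_trans (\sum_(i | P i) b)); first exact: leq_sum.
by rewrite sum_nat_const leq_mul2r max_card orbT.
Qed.

Lemma card_ffun_agree (aT rT : finType) (D : {set aT}) (f0 : {ffun aT -> rT}) :
  #|[set f : {ffun aT -> rT} | [forall x in D, f x == f0 x]]| = #|rT| ^ #|~: D|.
Proof.
pose F x : {pred rT} := if x \in D then pred1 (f0 x) else predT.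
transitivity #|family F|.
  apply: eq_card => f; rewrite inE; apply/forall_inP/familyP => fH x.
    by rewrite /F; case: ifP => // xD; rewrite inE fH.
  by move=> xD; have := fH x; rewrite /F xD inE.
rewrite card_family foldrE big_image /= (bigID (mem D)) /= big1 => [|x xD].
  rewrite mul1n -prod_nat_const; apply: eq_big => x; first by rewrite inE.
  by rewrite /F => /negbTE->.
by rewrite /F xD card1.
Qed.

(** * The edge set of an embedded copy *)

Section Copies.
Variables (H : sgraph) (N : nat).
Implicit Types phi : H -> 'I_N.

Definition copy_edges phi : {set {set 'I_N}} :=
  [set [set phi p.1; phi p.2] | p in [set p : H * H | edge p.1 p.2]].

Lemma mem_copy_edges phi x y : edge x y -> [set phi x; phi y] \in copy_edges phi.
Proof. by move=> xy; apply/imsetP; exists (x, y); rewrite ?inE. Qed.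

Lemma sum_degree : \sum_(x : H) degree x = #|[set p : H * H | edge p.1 p.2]|.
Proof.
rewrite -sum1_card (eq_bigl (fun p : H * H => predT p.1 && edge p.1 p.2)).
  rewrite -(pair_big_dep predT (fun x y : H => edge x y) (fun _ _ => 1)) /=.
  by apply: eq_bigr => x _; rewrite sum1dep_card.
by move=> p; rewrite inE.
Qed.

(** The degree sum counts ordered adjacent pairs; as [phi] is injective, only [(x, y)] and [(y, x)]
    map to the same edge of the copy. *)
Lemma sum_degree_copy phi : injective phi ->
  \sum_(x : H) degree x <= #|copy_edges phi| * 2.
Proof.
move=> phiI; rewrite sum_degree.
set P := [set p : H * H | _]; pose im (p : H * H) := [set phi p.1; phi p.2].
rewrite -sum1_card (partition_big im (mem (copy_edges phi))) /=; last first.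
  move=> p; rewrite inE => pE; exact: (mem_copy_edges phi pE).
rewrite -sum_nat_const; apply: leq_sum => _ /imsetP[[x y] _ ->].
rewrite sum1dep_card; apply: (@leq_trans #|[set (x, y); (y, x)]|).
  apply: subset_leq_card; apply/subsetP => -[x' y'].
  rewrite !inE /im /= => /andP[xy' /eqP e].
  have xy'n : x' != y' by apply: contraTneq xy' => ->; rewrite edge_irr.
  have {}e : [set x'; y'] = [set x; y].
    by apply: (imset_inj phiI); rewrite !imsetU !imset_set1.
  move/setP: e => e; move: (e x') (e y') xy'n.
  rewrite !inE !eqxx orbT /= => /esym + /esym.
  by case/orP => /eqP -> /orP[] /eqP ->; rewrite ?eqxx ?orbT // => /negP.
by rewrite cards2; case: eqP.
Qed.

End Copies.

(* The common weakening of monochromatic and lexicographic: [pi] is the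
   position in the ordering and the colors need not be distinct. *)
Definition ordered_coloring (H : sgraph) (N : nat) (chi : {set 'I_N} -> nat)
    (phi : H -> 'I_N) (pi : H -> 'I_#|H|) (c : H -> nat) :=
  forall x y, edge x y -> pi x < pi y -> chi [set phi x; phi y] = c x.

(** A monochromatic copy fits any ordering with constant [c]; for a lexicographic one, [pi] is the
    inverse of [v]. *)
Lemma canonical_cases (H : sgraph) (N : nat) (chi : {set 'I_N} -> nat)
    (phi : H -> 'I_N) : canonical chi phi ->
  {in copy_edges phi &, injective chi} \/
  exists pi c, injective pi /\ ordered_coloring chi phi pi c.
Proof.
case=> [[a ha]|[rb|[v [[pi vK piK] [c [_ hc]]]]]].
- right; exists enum_rank, (fun=> a); split; first exact: enum_rank_inj.
  by move=> x y xy _; apply: ha.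
- left=> _ _ /imsetP[[x y] xy ->] /imsetP[[x' y'] xy' ->] /=.
  rewrite !inE /= in xy xy' * => /(rb _ _ _ _ xy xy') e.
  by rewrite -!imset_set1 -!imsetU e.
- right; exists pi, (c \o pi); split; first exact: can_inj piK.
  by move=> x y xy lt /=; rewrite -(hc _ _ lt) ?piK.
Qed.

Lemma unavoidable_card (H : sgraph) N : canonical_unavoidable H N -> #|H| <= N.
Proof.
move=> /(_ (fun=> 0))[phi [phiI _]].
by rewrite -[N in _ <= N]card_ord -(card_codom phiI) max_card.
Qed.

(** * Union bound over the data describing a copy *)

Section Count.
Variables (H : sgraph) (N : nat).
Let n := #|H|.
Let datum : finType := ({ffun H -> 'I_N} * {ffun H -> 'I_n} * {ffun H -> 'I_n})%type.

Let good (d : datum) := injectiveb d.1.1 && injectiveb d.1.2.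

Let fits (d : datum) : {set {ffun {set 'I_N} -> 'I_n}} :=
  [set f : {ffun {set 'I_N} -> 'I_n} |
    [forall x, forall y, edge x y ==> (d.1.2 x < d.1.2 y) ==>
     (f [set d.1.1 x; d.1.1 y] == d.2 x)]].

Let fits_card d e : good d -> e * 2 <= (\sum_(x : H) degree x).+1 ->
  #|fits d| * n ^ e <= n ^ #|{set 'I_N}|.
Proof.
case: d => -[phi pi] c /andP[/injectiveP /= phiI /injectiveP /= piI] eS.
set d := (phi, pi, c).
(* Any two members of [fits d] agree on the edges of the copy, so one member [f0] serves as
   reference. *)
have [->|[f0 f0d]] := set_0Vmem (fits d); first by rewrite cards0.
have n0 : 0 < n := leq_ltn_trans (leq0n _) (ltn_ord (f0 set0)).
have eE : e <= #|copy_edges phi|.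
  have := leq_trans eS (sum_degree_copy phiI : _ < _.+1).
  by move: #|_| => k; lia.
have sub : fits d \subset
    [set f : {ffun {set 'I_N} -> 'I_n} | [forall A in copy_edges phi, f A == f0 A]].
  apply/subsetP => f fd; rewrite inE; apply/forall_inP => _ /imsetP[[x y] + ->] /=.
  rewrite inE /= => xy.
  have key x1 y1 : edge x1 y1 -> pi x1 < pi y1 ->
      f [set phi x1; phi y1] == f0 [set phi x1; phi y1].
    move=> xy1 lt1; move: fd f0d; rewrite !inE.
    move=> /forallP/(_ x1)/forallP/(_ y1); rewrite xy1 lt1 => /eqP->.
    by move=> /forallP/(_ x1)/forallP/(_ y1); rewrite xy1 lt1 => /eqP->.
  (* As [pi] is injective, one endpoint comes first, and [d.2] there fixes the color. *)
  have : pi x != pi y by apply: contraTneq xy => /piI->; rewrite edge_irr.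
  rewrite -val_eqE neq_ltn => /orP[/key|lt]; first exact.
  by rewrite setUC; apply: key; rewrite // edge_sym.
apply: leq_trans (leq_mul (subset_leq_card sub) (leqnn _)) _.
rewrite card_ffun_agree card_ord -expnD leq_pexp2l //.
by rewrite -(cardsC (copy_edges phi)) addnC leq_add2r.
Qed.

Lemma unavoidable_count e : canonical_unavoidable H N ->
  n * 2 < \sum_(x : H) degree x -> e * 2 <= (\sum_(x : H) degree x).+1 ->
  n ^ e <= N ^ n * n ^ (2 * n).
Proof.
move=> un nS eS.
have [n0|n0] := posnP n.
  move: nS; rewrite big1 ?ltn0 // => x _.
  by have := card0_eq n0 x; rewrite inE.
pose M := #|{set 'I_N}|.
have cover : [set: {ffun {set 'I_N} -> 'I_n}] \subset \bigcup_(d | good d) fits d.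
  apply/subsetP => f _; have [phi [phiI /canonical_cases]] := un (fun A => f A).
  case=> [fI|[pi [c [piI fc]]]].
    (* A rainbow copy would show more than [n] colors. *)
    have /leq_card_in : {in copy_edges phi &, injective f}.
      by move=> A B hA hB e'; apply: fI => //; rewrite e'.
    rewrite card_ord => le; have := leq_trans nS (sum_degree_copy phiI).
    by rewrite ltn_pmul2r // ltnNge le.
  (* The default of [insubd] can occur only at vertices without a later neighbour: elsewhere [c x]
     is a value of [f], hence below [n]. *)
  apply/bigcupP; exists ([ffun x => phi x], [ffun x => pi x],
      [ffun x => insubd (Ordinal n0) (c x)]).
    by apply/andP; split; apply/injectiveP => x y; rewrite /= !ffunE;
      [move/phiI | move/piI].
  rewrite inE; apply/forallP => x; apply/forallP => y /=; rewrite !ffunE.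
  by apply/implyP => xy; apply/implyP => lt; rewrite -(fc x y xy lt) valKd.
have cD : #|{: datum}| = N ^ n * n ^ (2 * n).
  by rewrite !card_prod !card_ffun !card_ord -mulnA -expnD mul2n addnn.
rewrite -cD -(@leq_pmul2l (n ^ M)) ?expn_gt0 ?n0 //.
have -> : n ^ M = #|[set: {ffun {set 'I_N} -> 'I_n}]|.
  by rewrite cardsT card_ffun card_ord.
have ne0 : 0 < n ^ e by rewrite expn_gt0 n0.
apply: leq_trans (leq_mul (subset_leq_card cover) (leqnn _)) _.
apply: leq_trans (leq_mul (card_bigcup_le (b := n ^ M %/ n ^ e) _) (leqnn _)) _.
  by move=> d gd; rewrite leq_divRL // fits_card.
rewrite cardsT card_ffun card_ord -/M -mulnA mulnC leq_mul2r.
by rewrite leq_trunc_div orbT.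
Qed.

End Count.

(** * From the count to the power bound *)

Lemma unavoidable_lower (H : sgraph) N : 0 < #|H| -> canonical_unavoidable H N ->
  #|H| ^ (\sum_(x : H) degree x) <= N ^ (16 * #|H|).
Proof.
move=> n0 un; have nN := unavoidable_card un.
set n := #|H| in n0 nN *; set S := \sum_x _.
rewrite leqNgt; apply/negP => lt.
have [n1|n1] := leqP n 1.
  have {}n1 : n = 1 by apply/eqP; rewrite eqn_leq n1.
  by move: lt; rewrite n1 exp1n ltnS leqn0 expn_eq0; lia.
(* If [S <= 16 * n], then [n <= N] already gives the claim. *)
have nS : 16 * n < S.
  rewrite -(ltn_exp2l _ _ n1); apply: leq_ltn_trans lt.
  by rewrite leq_exp2r // muln_gt0.
(* Rounding up avoids proving that [S] is even. *)
have cnt : n ^ uphalf S <= N ^ n * n ^ (2 * n).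
  by apply: unavoidable_count un _ _; rewrite -/n -/S; lia.
(* The 16th power of [cnt] contains [N ^ (16 * n)], assumed below [n ^ S]. The exponents clash: the
   left one is at least [8 * S], the right one below [3 * S]. *)
have : n ^ (uphalf S * 16) < n ^ (S + 32 * n).
  rewrite expnM expnD; apply: leq_ltn_trans (_ : (N ^ n * n ^ (2 * n)) ^ 16 < _).
    by rewrite leq_exp2r.
  rewrite expnMn -!expnM [n * 16]mulnC (_ : 2 * n * 16 = 32 * n); last by lia.
  by rewrite ltn_pmul2r // expn_gt0 n0.
by rewrite ltn_exp2l //; lia.
Qed.

Theorem theorem2p2 (R : realType) :
  exists c : R, (0 < c)%R /\
    forall (n : nat) (H : sgraph), 0 < n -> #|H| = n ->
      (n%:R `^ (c * avg_degree R H) <= (ER H)%:R)%R.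
Proof.
exists (16%:R^-1)%R; split; first by rewrite Num.Theory.invr_gt0 Num.Theory.ltr0n.
move=> n H n0 Hn.
have un : canonical_unavoidable H (ER H).
  by rewrite /ER; case: ex_minnP => N /boolp.asboolP.
have := unavoidable_lower _ un; rewrite Hn => /(_ n0) le.
have k0 : 0 < 16 * n by rewrite muln_gt0.
(* Raising to the power [16 * n] turns the exponent [c * d] into the degree sum, which leaves an
   inequality of naturals. *)
rewrite -(@Num.Theory.ler_pXn2r _ (16 * n)) ?Num.Theory.nnegrE ?powR_ge0
  ?Num.Theory.ler0n //.
rewrite -powR_mulrn ?powR_ge0 // -powRrM.
have -> : (16%:R^-1 * avg_degree R H * (16 * n)%:R
    = (\sum_(x : H) degree x)%:R :> R)%R.
  rewrite /avg_degree Hn GRing.natrM GRing.mulrACA GRing.divfK; last first.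
    by rewrite Num.Theory.pnatr_eq0 -lt0n.
  by rewrite GRing.mulVf ?GRing.mul1r // Num.Theory.pnatr_eq0.
by rewrite powR_mulrn ?Num.Theory.ler0n // -!GRing.natrX Num.Theory.ler_nat.
Qed.
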